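(* Let $\Delta$ be a non-empty finite flag complex. If $\Delta$ is simply connected (in particular connected), then the group $H_\Delta$ has a finite presentation.
   Context: A finite flag complex $\Delta$ is a finite simplicial complex that contains a simplex bounding (spanning) every complete subgraph of its 1-skeleton. The associated right-angled Artin group $G_\Delta$ is the group presented with generators the vertex set of $\Delta$ and relators the commutators $[v,w]$ for each pair of adjacent vertices $v,w$ of $\Delta$. For $\Delta$ non-empty, there is a homomorphism $G_\Delta\to\mathbf{Z}$ sending every generator to $1$, and $H_\Delta$ denotes its kernel. *)

(* Defs.v *)
From HB Require Import structures.
From mathcomp Require Import all_boot all_order all_algebra generic_quotient.
From mathcomp Require Import boolp classical_sets functions reals topology.
From mathcomp Require Import normedtype.

Set Implicit Arguments.
Unset Strict Implicit.
Unset Printing Implicit Defensive.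

Import Order.TTheory GRing.Theory Num.Theory.
Import numFieldNormedType.Exports.

Local Open Scope group_scope.
Local Open Scope classical_set_scope.
Local Open Scope quotient_scope.

(* A letter (x, true) stands for the generator x, and (x, false) for its
   inverse. *)
Notation word X := (seq (X * bool)).

Definition eval_word (X : Type) (G : groupType) (f : X -> G) (w : word X) : G :=
  \prod_(l <- w) (if l.2 then f l.1 else (f l.1)^-1).

Lemma eval_word_cat (X : Type) (G : groupType) (f : X -> G) (u v : word X) :
  eval_word f (u ++ v) = eval_word f u * eval_word f v.
Proof. by rewrite /eval_word big_cat. Qed.

Definition inv_word (X : Type) (w : word X) : word X :=
  rev [seq (l.1, ~~ l.2) | l <- w].

Section Presentation.
Variables (X : choiceType) (rels : set (word X)).

Inductive word_eq : word X -> word X -> Prop :=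
| WordRefl u : word_eq u u
| WordSym u v : word_eq u v -> word_eq v u
| WordTrans v u w : word_eq u v -> word_eq v w -> word_eq u w
| WordCat u u' v v' : word_eq u u' -> word_eq v v' -> word_eq (u ++ v) (u' ++ v')
| WordCancel x b : word_eq [:: (x, b); (x, ~~ b)] [::]
| WordRel r : rels r -> word_eq r [::].

Let eqw : rel (word X) := fun u v => `[< word_eq u v >].

Fact eqw_refl : reflexive eqw.
Proof. by move=> u; apply/asboolP; exact: WordRefl. Qed.

Fact eqw_sym : symmetric eqw.
Proof. by move=> u v; apply/asboolP/asboolP; exact: WordSym. Qed.

Fact eqw_trans : transitive eqw.
Proof.
by move=> v u w /asboolP uv /asboolP vw; apply/asboolP; exact: WordTrans uv vw.
Qed.

Definition word_equiv := EquivRel eqw eqw_refl eqw_sym eqw_trans.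

Definition presented := {eq_quot word_equiv}.
HB.instance Definition _ := Choice.on presented.

Definition of_word (w : word X) : presented := \pi_presented w.

Definition gen (x : X) : presented := of_word [:: (x, true)].

Lemma of_wordP u v : of_word u = of_word v <-> word_eq u v.
Proof. by split=> [/eqmodP/asboolP|?] //; apply/eqmodP/asboolP. Qed.

Lemma of_wordK (p : presented) : of_word (repr p) = p.
Proof. exact: reprK. Qed.

Lemma word_eq_repr w : word_eq (repr (of_word w)) w.
Proof. by apply/of_wordP; rewrite of_wordK. Qed.

Definition presented_mul (p q : presented) := of_word (repr p ++ repr q).
Definition presented_inv (p : presented) := of_word (inv_word (repr p)).

Lemma of_word_mul u v :
  presented_mul (of_word u) (of_word v) = of_word (u ++ v).
Proof. by apply/of_wordP/WordCat; exact: word_eq_repr. Qed.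

Fact presented_mulA : associative presented_mul.
Proof.
move=> p q r; rewrite -[p]of_wordK -[q]of_wordK -[r]of_wordK.
by rewrite !of_word_mul catA.
Qed.

Fact presented_1mul : left_id (of_word [::]) presented_mul.
Proof. by move=> p; rewrite -[p]of_wordK of_word_mul. Qed.

Fact presented_mul1 : right_id (of_word [::]) presented_mul.
Proof. by move=> p; rewrite -[p]of_wordK of_word_mul cats0. Qed.

Lemma inv_word_cat (u v : word X) :
  inv_word (u ++ v) = inv_word v ++ inv_word u.
Proof. by rewrite /inv_word map_cat rev_cat. Qed.

Lemma inv_wordK : involutive (@inv_word X).
Proof.
move=> w; rewrite /inv_word map_rev revK -map_comp -[RHS]map_id.
by apply: eq_map => -[x b] /=; rewrite negbK.
Qed.

Lemma word_eq_mulV (w : word X) : word_eq (w ++ inv_word w) [::].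
Proof.
elim: w => [|[x b] w IHw]; first exact: WordRefl.
rewrite -[_ :: w]cat1s inv_word_cat -catA [w ++ _]catA.
apply: (WordTrans (v := [:: (x, b)] ++ [::] ++ inv_word [:: (x, b)])).
  by apply: WordCat (WordRefl _) _; apply: WordCat IHw (WordRefl _).
exact: WordCancel.
Qed.

Fact presented_mulVg : left_inverse (of_word [::]) presented_inv presented_mul.
Proof.
move=> p; rewrite /presented_inv -{2}[p]of_wordK of_word_mul.
by apply/of_wordP; rewrite -{2}[repr p]inv_wordK; exact: word_eq_mulV.
Qed.

Fact presented_mulgV : right_inverse (of_word [::]) presented_inv presented_mul.
Proof.
move=> p; rewrite /presented_inv -{1}[p]of_wordK of_word_mul.
by apply/of_wordP; exact: word_eq_mulV.
Qed.

HB.instance Definition _ := isGroup.Build presented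
  presented_mulA presented_1mul presented_mul1 presented_mulVg presented_mulgV.

Lemma of_wordM u v : of_word (u ++ v) = of_word u * of_word v.
Proof. exact/esym/of_word_mul. Qed.

End Presentation.

Section UniversalProperty.
Variables (X : choiceType) (rels : set (word X)) (G : groupType) (f : X -> G).
Hypothesis f_rels : forall r, rels r -> eval_word f r = 1.

Lemma eval_word_eq u v : word_eq rels u v -> eval_word f u = eval_word f v.
Proof.
elim=> {u v} [u|u v _ ->|v u w _ -> _ ->|u u' v v' _ Eu _ Ev|x b|r /f_rels ->] //.
- by rewrite !eval_word_cat Eu Ev.
- rewrite /eval_word big_cons big_seq1 big_nil /=.
  by case: b; rewrite /= ?mulgV ?mulVg.
- by rewrite /eval_word big_nil.
Qed.

Definition presented_lift (p : presented rels) : G :=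
  let _ := f_rels in eval_word f (repr p).

Lemma presented_lift_word w : presented_lift (of_word rels w) = eval_word f w.
Proof. exact/eval_word_eq/word_eq_repr. Qed.

Fact presented_lift_is_morphism : monoid.monoid_morphism presented_lift.
Proof.
split=> [|p q]; first by rewrite presented_lift_word /eval_word big_nil.
rewrite -[p]of_wordK -[q]of_wordK -of_wordM.
by rewrite !presented_lift_word eval_word_cat.
Qed.

HB.instance Definition _ := isUMagmaMorphism.Build (presented rels) G
  presented_lift presented_lift_is_morphism.

Lemma presented_lift_gen x : presented_lift (gen rels x) = f x.
Proof. by rewrite presented_lift_word /eval_word big_seq1. Qed.

End UniversalProperty.

Definition finitely_presented (G : groupType) : Prop :=
  exists (X : finType) (rels : seq (word X))
         (phi : {multiplicative presented [set` rels] -> G}), bijective phi.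

Definition kernel (G H : groupType) (f : UMagmaMorphism.type G H) : Type :=
  {x : G | f x == 1}.

Section Kernel.
Variables (G H : groupType) (f : UMagmaMorphism.type G H).

Fact kernel_closed : group_closed [pred x : G | f x == 1].
Proof.
split=> [|x y]; rewrite !inE ?gmulf1 // => /eqP fx /eqP fy.
by rewrite gmulfF fx fy divgg.
Qed.

HB.instance Definition _ := SubChoice.on (kernel f).
HB.instance Definition _ :=
  SubChoice_isSubGroup.Build G [pred x : G | f x == 1] (kernel f) kernel_closed.

End Kernel.

(* Every element of V is a vertex, and the empty set is not a simplex. *)
Record simplicial_complex (V : finType) := SimplicialComplex {
  simplices : {set {set V}};
  simplex_neq0 : finset.set0 \notin simplices;
  simplex_vertex : forall v : V, [set v]%SET \in simplices;
  simplex_face : forall s t : {set V}, s \in simplices -> t \subset s ->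
    t != finset.set0 -> t \in simplices
}.

Definition adjacent (V : finType) (K : simplicial_complex V) : rel V :=
  fun v w => (v != w) && ([set v; w]%SET \in simplices K).

Definition flag (V : finType) (K : simplicial_complex V) : Prop :=
  forall s : {set V}, s != finset.set0 ->
    {in s &, forall v w, v != w -> adjacent K v w} -> s \in simplices K.

(* The geometric realization, in barycentric coordinates. *)
Definition realization (R : realType) (V : finType) (K : simplicial_complex V) :
    set {ptws V -> R} :=
  [set x : {ptws V -> R} | [/\ forall v, (0 <= x v)%R, (\sum_v x v = 1)%R
    & [set v | x v != 0%R]%SET \in simplices K]].
Arguments realization R {V} K.

Section SimplyConnected.
Variables (R : realType) (T : topologicalType) (A : set T).

Local Notation I := (`[0%R, 1%R] : set R).

Definition path_in (x y : T) (g : R -> T) : Prop :=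
  [/\ {within I, continuous g}, g @` I `<=` A, g 0%R = x & g 1%R = y].

Definition path_connected : Prop :=
  forall x y, A x -> A y -> exists g, path_in x y g.

(* A homotopy, relative to the endpoints, from the loop g to the constant loop. *)
Definition null_homotopic (x : T) (g : R -> T) : Prop :=
  exists F : R * R -> T,
    [/\ {within I `*` I, continuous F}, F @` (I `*` I) `<=` A,
        forall t, I t -> F (0%R, t) = g t, forall t, I t -> F (1%R, t) = x
      & forall s, I s -> F (s, 0%R) = x /\ F (s, 1%R) = x].

Definition simply_connected : Prop :=
  [/\ A !=set0, path_connected
    & forall x g, path_in x x g -> null_homotopic x g].

End SimplyConnected.
Arguments simply_connected R {T} A.

Section Artin.
Variables (V : finType) (K : simplicial_complex V).

Definition commutator_word (v w : V) : word V :=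
  [:: (v, false); (w, false); (v, true); (w, true)].

Definition artin_rels : set (word V) :=
  [set r | exists v w, adjacent K v w /\ r = commutator_word v w].

Definition artin_group : groupType := presented artin_rels.

Definition to_one (v : V) : Algebra.to_multiplicative int := 1%Z.

Fact degree_rels r : artin_rels r -> eval_word to_one r = 1.
Proof.
by move=> [v [w [_ ->]]]; rewrite /eval_word !big_cons big_nil.
Qed.

(* Z is written multiplicatively; every generator is sent
   to the integer 1, see degree_gen. *)
Definition degree : UMagmaMorphism.type artin_group (Algebra.to_multiplicative int) :=
  presented_lift degree_rels.

Lemma degree_gen v : degree (gen artin_rels v) = 1%Z.
Proof. exact: presented_lift_gen. Qed.

Definition degree_kernel : groupType := kernel degree.

End Artin.

(* Main.v *)
Require Import Defs.
From mathcomp Require Import all_boot all_order all_algebra.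
From mathcomp Require Import boolp classical_sets functions reals topology normedtype.
From mathcomp Require Import ring lra.
Import numFieldNormedType.Exports.

(** A cocycle on the closed edges of K with values in a group (multiplicative
    on triangles) is a coboundary as soon as the realization is simply
    connected: sample a null-homotopy of an edge loop on a fine grid and label
    each grid point by a vertex of large barycentric coordinate; each small
    square is labelled within one simplex, so the products of the cocycle along
    the rows of the grid agree.

    Let P be generated by the edges (v, w), subject to: on each triangle, edges
    compose and commute.  Write (v, w) = h v / h w = k w / k v for two functions
    h, k on vertices that are trivial at a base vertex a.  Conjugation by the
    inverse of h v agrees on the edges of a simplex for all its vertices v, hence
    glues to an endomorphism th of P, whose inverse is obtained likewise from k.
    Letting a vertex v act on P by p |-> h v * th p gives an action of the Artin
    group on P in which the edge (v, w), sent to v / w, acts by left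
    multiplication; this makes P -> H injective, and moving 1 by this
    action inverts it. *)

Set Implicit Arguments.
Unset Strict Implicit.
Unset Printing Implicit Defensive.

Import Order.TTheory GRing.Theory Num.Theory.

Local Open Scope group_scope.

(** * Words and homomorphisms out of a presented group *)

Lemma eval_word_morph (X : Type) (G H : groupType) (f : UMagmaMorphism.type G H)
    (g : X -> G) (w : word X) :
  f (eval_word g w) = eval_word (f \o g) w.
Proof.
rewrite /eval_word gmulf_prod; apply: eq_bigr => -[x []] _ //=.
by rewrite gmulfV.
Qed.

Lemma eval_word_gen (X : choiceType) (rels : set (word X)) (w : word X) :
  eval_word (gen rels) w = of_word rels w.
Proof.
elim: w => [|[x b] w IHw]; first by rewrite /eval_word big_nil.
rewrite -cat1s eval_word_cat IHw of_wordM; congr (_ * _).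
rewrite /eval_word big_seq1; case: b => //=.
apply/mulg1_eq; rewrite -of_wordM.
by apply/of_wordP; apply: WordCancel.
Qed.

Lemma of_word_surj (X : choiceType) (rels : set (word X)) (p : presented rels) :
  exists w, p = of_word rels w.
Proof. by exists (repr p); rewrite of_wordK. Qed.

Lemma presented_ext (X : choiceType) (rels : set (word X)) (H : groupType)
    (f g : UMagmaMorphism.type (presented rels) H) :
  (forall x, f (gen rels x) = g (gen rels x)) -> f =1 g.
Proof.
move=> fg p; have [w ->] := of_word_surj p.
rewrite -eval_word_gen !eval_word_morph /eval_word.
by apply: eq_bigr => l _ /=; rewrite fg.
Qed.

(** * Cocycles on closed edges *)

Definition closed_nbr (V : finType) (K : simplicial_complex V) : rel V :=
  fun v w => (v == w) || adjacent K v w.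

Section Close.
Variables (V : finType) (K : simplicial_complex V).
Local Notation close := (closed_nbr K).

Lemma closed_nbr_refl v : close v v.
Proof. by rewrite /closed_nbr eqxx. Qed.

Lemma closed_nbr_sym v w : close v w = close w v.
Proof. by rewrite /closed_nbr /adjacent eq_sym finset.setUC. Qed.

(** Degenerate triangles are included, so the identity also encodes [c v v = 1] and
    [c w v = (c v w)^-1]. *)
Definition cocycle (Q : groupType) (c : V -> V -> Q) :=
  forall v w u, close v w -> close w u -> close v u ->
    c v w * c w u = c v u.

Section CocycleTheory.
Variables (Q : groupType) (c : V -> V -> Q).
Hypothesis c_cocycle : cocycle c.

Lemma cocycle1 v : c v v = 1.
Proof.
have vv := closed_nbr_refl v.
by apply: (mulgI (c v v)); rewrite mulg1 c_cocycle.
Qed.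

Lemma cocycleV v w : close v w -> c w v = (c v w)^-1.
Proof.
move=> vw; apply/esym/mulg1_eq.
by rewrite c_cocycle ?closed_nbr_refl ?cocycle1 // closed_nbr_sym.
Qed.

End CocycleTheory.

End Close.

(** * The presentation *)

Section Presentation.
Variables (V : finType) (K : simplicial_complex V) (a : V).
Local Notation close := (closed_nbr K).

(** Simple connectivity enters the algebra only through these two statements: connectedness of the
    1-skeleton, as an induction principle, and triviality of cocycles. *)
Hypothesis conn : forall S : V -> Prop, S a ->
  (forall v w, close v w -> S v -> S w) -> forall v, S v.
Hypothesis triv : forall (Q : groupType) (c : V -> V -> Q), cocycle K c ->
  exists h : V -> Q, h a = 1 /\ forall v w, close v w -> c v w = h v / h w.

Definition triangle_word (t : V * V * V) : word (V * V) :=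
  let: (v, w, u) := t in
  [:: ((v, w), true); ((w, u), true); ((v, u), false)].

Definition triangle_comm_word (t : V * V * V) : word (V * V) :=
  let: (v, w, u) := t in
  [:: ((v, w), true); ((w, u), true); ((v, w), false); ((w, u), false)].

Definition triangle (t : V * V * V) : bool :=
  let: (v, w, u) := t in [&& close v w, close w u & close v u].

(** All of [V * V] serves as generating type, so that it is a [finType]; the first relators kill the
    pairs that are not closed edges. *)
Definition edge_rels : seq (word (V * V)) :=
  [seq [:: (e, true)] | e <- enum [pred e : V * V | ~~ close e.1 e.2]] ++
  [seq triangle_word t | t <- enum triangle] ++
  [seq triangle_comm_word t | t <- enum triangle].

Local Notation P := (presented [set` edge_rels]).

Definition edge v w : P := gen [set` edge_rels] (v, w).

Lemma edge_rels_ind (S : word (V * V) -> Prop) :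
  (forall v w, ~~ close v w -> S [:: ((v, w), true)]) ->
  (forall v w u, close v w -> close w u -> close v u ->
     S (triangle_word (v, w, u)) /\ S (triangle_comm_word (v, w, u))) ->
  forall r, [set` edge_rels]%classic r -> S r.
Proof.
move=> S1 S2 r; rewrite /= !mem_cat => /or3P[] /mapP[].
- by move=> [v w]; rewrite mem_enum => /S1 ? ->.
- by move=> [[v w] u]; rewrite mem_enum => /and3P[vw wu vu] ->; case: (S2 v w u).
- by move=> [[v w] u]; rewrite mem_enum => /and3P[vw wu vu] ->; case: (S2 v w u).
Qed.

Lemma edge_far v w : ~~ close v w -> edge v w = 1.
Proof.
move=> vw; apply/of_wordP/WordRel; rewrite /= mem_cat; apply/orP; left.
by apply/mapP; exists (v, w); rewrite ?mem_enum.
Qed.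

Lemma edge_triangle v w u : close v w -> close w u -> close v u ->
  edge v w * edge w u = edge v u.
Proof.
move=> vw wu vu; apply/divg1_eq.
have <- : eval_word (gen [set` edge_rels]) (triangle_word (v, w, u)) =
    edge v w * edge w u / edge v u.
  by rewrite /eval_word !big_cons big_nil mulg1 mulgA.
rewrite eval_word_gen; apply/of_wordP/WordRel; rewrite /= !mem_cat.
apply/or3P; constructor 2; apply/mapP; exists (v, w, u) => //.
by rewrite mem_enum; apply/and3P.
Qed.

Lemma edge_comm v w u : close v w -> close w u -> close v u ->
  edge v w * edge w u = edge w u * edge v w.
Proof.
move=> vw wu vu; apply/divg1_eq.
have <- : eval_word (gen [set` edge_rels]) (triangle_comm_word (v, w, u)) =
    edge v w * edge w u / (edge w u * edge v w).
  by rewrite /eval_word !big_cons big_nil mulg1 invgM !mulgA.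
rewrite eval_word_gen; apply/of_wordP/WordRel; rewrite /= !mem_cat.
apply/or3P; constructor 3; apply/mapP; exists (v, w, u) => //.
by rewrite mem_enum; apply/and3P.
Qed.

Definition edge_lift_fun (Q : groupType) (c : V -> V -> Q) (e : V * V) : Q :=
  if close e.1 e.2 then c e.1 e.2 else 1.

Lemma edge_liftP (Q : groupType) (c : V -> V -> Q) :
  cocycle K c ->
  (forall v w u, close v w -> close w u -> close v u ->
    c v w * c w u = c w u * c v w) ->
  exists f : UMagmaMorphism.type P Q,
    forall v w, close v w -> f (edge v w) = c v w.
Proof.
move=> cc ccomm.
have cr r : [set` edge_rels]%classic r -> eval_word (edge_lift_fun c) r = 1.
  move: r; apply: edge_rels_ind => [v w nvw | v w u vw wu vu].
    by rewrite /eval_word big_seq1 /edge_lift_fun /= (negbTE nvw).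
  rewrite /eval_word !big_cons !big_nil !mulg1 /edge_lift_fun /= vw wu vu.
  by rewrite !mulgA cc // mulgV -(cc v w u) // ccomm // mulgK mulgV.
exists (presented_lift cr) => v w vw.
apply: (etrans (presented_lift_gen cr (v, w))).
by rewrite /edge_lift_fun /= vw.
Qed.

Lemma edge_ext (Q : groupType) (f g : UMagmaMorphism.type P Q) :
  (forall v w, close v w -> f (edge v w) = g (edge v w)) -> f =1 g.
Proof.
move=> fg; apply: presented_ext => -[v w]; rewrite -/(edge v w).
by case: (boolP (close v w)) => [/fg //|/edge_far ->]; rewrite !gmulf1.
Qed.


(** The inverse of an edge is the reversed edge, so left multiplication by edges alone reaches all
    of [P]. *)
Lemma edge_ind (S : P -> Prop) : S 1 ->
  (forall v w p, close v w -> S p -> S (edge v w * p)) -> forall p, S p.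
Proof.
move=> S1 SM p; have [w ->] := of_word_surj p; rewrite -eval_word_gen.
elim: w => [|[[v w] b] u IHu]; first by rewrite /eval_word big_nil.
rewrite /eval_word big_cons -/(eval_word _ _) /= -/(edge v w).
have [vw|/edge_far ->] := boolP (close v w); last first.
  by rewrite invg1 if_same mul1g.
case: b; first exact: SM.
by rewrite -(cocycleV edge_triangle vw); apply: SM; rewrite // closed_nbr_sym.
Qed.

(** Commutation lets the triangle relation be read backwards; [triv] applied to this cocycle yields
    the second potential [k]. *)
Lemma edge_op_cocycle : cocycle K (fun v w => edge w v).
Proof.
move=> v w u vw wu vu.
by rewrite -edge_comm ?edge_triangle // closed_nbr_sym.
Qed.

(* Under the isomorphism with the kernel, [edge v w], [h v], [k v] (below) and
   [th] become v / w, v / a, v^-1 * a and conjugation by a. *)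
Lemma twist_exists : exists (h : V -> P) (th th' : UMagmaMorphism.type P P),
  [/\ h a = 1, forall v w, close v w -> edge v w = h v / h w,
      forall v w, close v w -> th (edge v w) = (h w)^-1 * h v,
      cancel th th' & cancel th' th].
Proof.
have [h [ha hE]] := triv edge_triangle.
have [k [ka kE']] := triv edge_op_cocycle.
have kE v w : close v w -> edge v w = k w / k v.
  by rewrite closed_nbr_sym; apply: kE'.
(* [c] and [c'] are the intended values of [th] and [th'] on edges. For [c], the product in path
   order needs commutation in [P] and the product in reverse order telescopes; for [c'], path order
   telescopes and reverse order needs the triangle relation. *)
pose c v w := (h w)^-1 * h v; pose c' v w := (k v)^-1 * k w.
have cc : cocycle K c.
  move=> v w u vw wu vu; have := edge_comm vw wu vu.
  rewrite !hE // /c !mulgA mulgVK => E; apply: (mulgI (h w)).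
  by rewrite !mulgA mulgV mul1g; apply: (mulIg (h w)^-1); rewrite mulgK E.
have cC v w u : close v w -> close w u -> close v u ->
    c v w * c w u = c w u * c v w.
  by move=> vw wu vu; rewrite cc // /c mulgA mulgK.
have cc' : cocycle K c' by move=> v w u _ _ _; rewrite /c' mulgA mulgK.
have cC' v w u : close v w -> close w u -> close v u ->
    c' v w * c' w u = c' w u * c' v w.
  move=> vw wu vu; rewrite cc' //; have := edge_triangle vw wu vu.
  rewrite !kE // /c' !mulgA => E; apply: (mulgI (k w)).
  by rewrite !mulgA mulgV mul1g; apply: (mulIg (k w)^-1); rewrite mulgK E.
have [th thE] := edge_liftP cc cC; have [th' thE'] := edge_liftP cc' cC'.
(* Both sides are 1 at [a], and the identity propagates along edges; with [thh] it shows that [th]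
   and [th'] undo each other on edges. *)
have thk : forall v, th (k v) = (h v)^-1.
  apply: conn => [|v w vw IHv]; first by rewrite ka ha gmulf1 invg1.
  by rewrite -[k w](mulgVK (k v)) -kE // gmulfM IHv thE // /c mulgK.
have thh : forall v, th' (h v) = (k v)^-1.
  apply: conn => [|v w vw IHv]; first by rewrite ka ha gmulf1 invg1.
  have wv : close w v by rewrite closed_nbr_sym.
  by rewrite -[h w](mulgVK (h v)) -hE // gmulfM IHv thE' // /c' mulgK.
exists h, th, th'; split=> //.
- apply: (@edge_ext _ (th' \o th : UMagmaMorphism.type P P) idfun) => v w vw /=.
  by rewrite thE // /c gmulfM gmulfV !thh invgK kE.
- apply: (@edge_ext _ (th \o th' : UMagmaMorphism.type P P) idfun) => v w vw /=.
  by rewrite thE' // /c' gmulfM gmulfV !thk invgK hE.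
Qed.

(** * Comparison of [P] with the kernel *)

Local Notation G := (artin_group K).
Local Notation x := (gen (artin_rels K)).

Lemma artin_ind (S : G -> Prop) : S 1 ->
  (forall v g, S g -> S (x v * g)) -> (forall v g, S g -> S ((x v)^-1 * g)) ->
  forall g, S g.
Proof.
move=> S1 SM SV g; have [w ->] := of_word_surj g; rewrite -eval_word_gen.
elim: w => [|[v b] u IHu]; first by rewrite /eval_word big_nil.
rewrite /eval_word big_cons -/(eval_word _ _) /=.
by case: b; [apply: SM|apply: SV].
Qed.

Lemma artin_commute v w : close v w -> commute (x v) (x w).
Proof.
case/predU1P=> [-> //|vw]; rewrite /commute -[RHS]invgK; apply/esym/mulg1_eq.
have <- : eval_word x (commutator_word v w) = (x w * x v)^-1 * (x v * x w).
  by rewrite /eval_word !big_cons big_nil mulg1 invgM !mulgA.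
by rewrite eval_word_gen; apply/of_wordP/WordRel; exists v, w.
Qed.

(** The comparison map: the cocycle identity for v / w is formal, and commutation on a triangle
    comes from the Artin relators. *)
Lemma artin_edge_exists :
  exists f : UMagmaMorphism.type P (degree_kernel K),
    forall v w, close v w -> val (f (edge v w)) = x v / x w.
Proof.
have xk v w : degree K (x v / x w) == 1.
  by rewrite gmulfF !degree_gen divgg.
pose c v w : degree_kernel K := Sub (x v / x w) (xk v w).
have [v w u vw wu vu|v w u vw wu vu|f fE] := @edge_liftP _ c.
- by apply: val_inj; rewrite valM !SubK mulgA mulgVK.
- apply: val_inj; rewrite !valM !SubK !mulgA mulgVK.
  have wV : commute (x w) (x u)^-1 by apply/commuteV/artin_commute.
  rewrite wV -[_ * x w * x v]mulgA (commute_sym (artin_commute vw)).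
  rewrite mulgA mulgK; apply/esym/commute_sym/commuteV.
  exact: artin_commute.
- by exists f => v w vw; rewrite fE // SubK.
Qed.

Theorem degree_kernel_presented : finitely_presented (degree_kernel K).
Proof.
have [h [th [th' [ha hE thE thK th'K]]]] := twist_exists.
have [f fE] := artin_edge_exists.
pose F p : G := val (f p).
have FM p q : F (p * q) = F p * F q by rewrite /F gmulfM valM.
have F1 : F 1 = 1 by rewrite /F gmulf1 val1.
have FV p : F p^-1 = (F p)^-1 by apply/esym/mulg1_eq; rewrite -FM mulgV.
(* Read in the Artin group, [h v * th p] is (v / a) * (a * p / a) = v * p / a: left multiplication
   by v, corrected on the right to stay in degree 0. *)
pose act (w : word V) p :=
  foldr (fun l q => if l.2 then h l.1 * th q else th' ((h l.1)^-1 * q)) p w.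
have actC u w p : act (u ++ w) p = act u (act w p) by rewrite /act foldr_cat.
(* This symmetry makes the operators of adjacent vertices commute, so that [act] descends to the
   Artin group. *)
have hth v w : close v w -> h v * th (h w) = h w * th (h v).
  move=> vw; rewrite -[h v in RHS](mulgVK (h w)) -hE // gmulfM thE //.
  by rewrite !mulgA mulgV mul1g.
have actE u w : word_eq (artin_rels K) u w -> act u =1 act w.
  elim=> {u w} [//|u w _ E p|u w t _ E1 _ E2 p|u u' w w' _ E1 _ E2 p|v b p|r].
  - by rewrite E.
  - by rewrite E1 E2.
  - by rewrite !actC E2 E1.
  - by case: b; rewrite /act /= ?th'K ?thK ?mulVKg ?mulKg // thK.
  - move=> [v [w [vw ->]]] p; have cvw : close v w by rewrite /closed_nbr vw orbT.
    have E q : h v * th (h w * q) = h w * th (h v * q).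
      by rewrite !gmulfM !mulgA hth.
    by rewrite /act /= E mulKg thK mulKg thK.
pose A (g : G) := act (repr g).
have AM g g' p : A (g * g') p = A g (A g' p).
  rewrite /A -actC; apply/actE/of_wordP.
  by rewrite of_wordM !of_wordK.
have A1 p : A 1 p = p by apply: (actE _ [::]); apply: word_eq_repr.
have Ax v p : A (x v) p = h v * th p.
  by apply: (actE _ [:: (v, true)]); apply: word_eq_repr.
have AxV v p : A (x v)^-1 p = th' ((h v)^-1 * p).
  by rewrite -[p in LHS](mulVKg (h v)) -[_ * p in LHS]th'K -Ax -AM mulVg A1.
(* In v / w the twists [th] and [th'] cancel, so an edge acts by left multiplication; evaluating at
   1 gives a left inverse of [f]. *)
have AF p q : A (F p) q = p * q.
  elim/edge_ind: p => [|v w p vw IHp]; first by rewrite F1 A1 mul1g.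
  rewrite FM AM IHp /F fE // AM AxV Ax th'K hE //.
  by rewrite !mulgA.
have Fh : forall v, F (h v) = x v / x a.
  apply: conn => [|v w vw IHv]; first by rewrite ha F1 mulgV.
  have wv : close w v by rewrite closed_nbr_sym.
  rewrite -[h w](mulgVK (h v)) -hE // FM IHv /F fE //.
  by rewrite mulgA mulgVK.
have Fth p : F (th p) = x a * F p / x a.
  elim/edge_ind: p => [|v w p vw IHp].
    by rewrite gmulf1 F1 mulg1 mulgV.
  rewrite gmulfM !FM IHp thE // FM FV !Fh /F fE // invgF !mulgA mulgVK.
  congr (_ * _ * _); rewrite -[RHS]mulgA -[LHS]mulgA; congr (_ * _).
  exact: (commute_sym (commuteV (artin_commute vw))).
have Fth' p : F (th' p) = (x a)^-1 * F p * x a.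
  by rewrite -[p in RHS]th'K Fth !mulgA mulVg mul1g mulgVK.
pose d (g : G) : int := degree K g.
have d1 : d 1 = 0%R by rewrite /d gmulf1.
have dM g g' : d (g * g') = (d g + d g')%R by rewrite /d gmulfM.
have dV g : d g^-1 = (- d g)%R by rewrite /d gmulfV.
have dx v : d (x v) = 1%R by rewrite /d degree_gen.
(* [i] and [j] count the positive and inverse letters of a word for [g]. Each letter leaves one
   factor [(x a)^-1] or [x a] on the right; in degree 0, [i = j] and these cancel. *)
have FA g : exists i j : nat, d g = (i%:Z - j%:Z)%R /\
    forall p, F (A g p) = g * F p * (x a ^+ j * x a ^- i).
  elim/artin_ind: g => [|v g [i [j [dg IHg]]]|v g [i [j [dg IHg]]]].
  - exists 0%N, 0%N; split=> [|p]; first by rewrite d1.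
    by rewrite A1 !expg0 invg1 !mul1g !mulg1.
  - exists i.+1, j; split=> [|p].
      by rewrite dM dg dx intS addrA.
    by rewrite AM Ax FM Fth IHg Fh expgS invgM !mulgA mulgVK.
  - exists i, j.+1; split=> [|p].
      by rewrite dM dV dg dx intS opprD addrCA.
    rewrite AM AxV Fth' FM FV IHg Fh invgF !mulgA mulVg mul1g.
    rewrite -!mulgA; do 3!congr (_ * _).
    rewrite expgSr -mulgA; congr (_ * _); apply: commute_sym.
    exact: (commuteV (commuteX i (commute_refl _))).
exists (V * V)%type, edge_rels, f.
exists (fun y => A (val y) 1) => [p|y]; first by rewrite AF mulg1.
apply: val_inj; have [i [j [dy /(_ 1)]]] := FA (val y).
rewrite -/(F _) => ->; rewrite F1 mulg1.
have/eqP := valP y; rewrite /= -/(d _) dy => /eqP; rewrite subr_eq0 => /eqP[->].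
by rewrite mulgV mulg1.
Qed.

End Presentation.

(** * Triviality of cocycles over a simply connected complex *)

Section UniformContinuity.
Local Open Scope classical_set_scope.

(** Heine-Cantor: as [V] is finite, the coordinatewise estimates hold on a common neighbourhood of
    each point, and compactness makes the radius uniform. *)
Lemma uniformly_continuous_on (R : realType) (V : finType)
    (T : pseudoMetricType R) (A : set T) (f : T -> {ptws V -> R}) (e : R) :
  compact A -> {within A, continuous f} -> (0 < e)%R ->
  exists2 d : R, (0 < d)%R & forall x y, A x -> A y -> ball x d y ->
    forall v, (`|f x v - f y v| < e)%R.
Proof.
move=> cA cf e0.
pose Q (d : R) (x : T) := forall y, A x -> A y -> ball x d y ->
    forall v, (`|f x v - f y v| < e)%R.
have : \forall d \near 0^'+, A `<=` Q d.
  apply: (proj1 (compact_near_coveringP A) cA) => x Ax.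
  have : \forall y \near x, forall v, A y -> (`|f x v - f y v| < e / 2)%R.
    apply: filter_forall => v.
    have /subspace_continuousP/(_ x Ax) fx := cf.
    have fxv := cvg_comp _ _ fx (@proj_continuous V (fun=> R) v (f x)).
    by move/cvgrPdist_lt/(_ (e / 2)%R): fxv; rewrite divr_gt0 //; apply.
  move=> /nbhs_ballP[r /= r0 Hr].
  (* Halving the radius keeps both [x'] and [y] inside the ball about [x] where the estimate by
     [e / 2] holds. *)
  exists (ball x (r / 2), [set d | 0 < d < r / 2]%R) => /=.
    split; first by apply: nbhsx_ballx; rewrite divr_gt0.
    near=> d; apply/andP; split; first by near: d; exact: nbhs_right_gt.
    by near: d; apply: nbhs_right_lt; rewrite divr_gt0.
  move=> [x' d] /= [xx' /andP[d0 dr]] y Ax' Ay x'y v.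
  have x'r : ball x r x' by apply: le_ball xx'; move: r0; lra.
  have yr : ball x r y.
    rewrite [r]splitr; apply: ball_triangle xx' _; exact: le_ball (ltW dr) _ x'y.
  have -> : (f x' v - f y v = (f x v - f y v) - (f x v - f x' v))%R.
    by ring.
  rewrite [e]splitr; apply: le_lt_trans (ler_normB _ _) _.
  by apply: ltrD; apply: Hr.
move=> nearQ; have [d [d0 Qd]] := filter_ex (filterI (nbhs_right_gt 0%R) nearQ).
by exists d => // x y Ax Ay; apply: Qd.
Unshelve. all: by end_near. Qed.

Lemma continuous_ptws (R : realType) (V : finType) (T : topologicalType)
    (g : T -> {ptws V -> R}) :
  (forall v, continuous (fun t => g t v)) -> continuous g.
Proof.
move=> cg x; apply/cvg_sup => v.
exact: (@continuous_comp_initial _ T R (fun p : {ptws V -> R} => p v) g (cg v)).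
Qed.

End UniformContinuity.

(** * Holonomy along edge paths *)

Section Holonomy.
Local Open Scope group_scope.
Variables (V : finType) (K : simplicial_complex V) (Q : groupType).
Variables (c : V -> V -> Q).
Hypothesis c_cocycle : cocycle K c.
Local Notation close := (closed_nbr K).

Lemma simplex_closed_nbr (s : {set V}) v w :
  s \in simplices K -> v \in s -> w \in s -> close v w.
Proof.
move=> sK vs ws; rewrite /closed_nbr /adjacent; case: eqVneq => //= vw.
apply: simplex_face sK _ _; first by rewrite finset.subUset !finset.sub1set vs.
by apply/finset.set0Pn; exists v; rewrite !inE eqxx.
Qed.

Lemma closed_nbr_simplex v w : close v w -> [set v; w]%SET \in simplices K.
Proof. by case/predU1P=> [->|/andP[] //]; rewrite finset.setUid simplex_vertex. Qed.

Definition holonomy (l : nat -> V) (n : nat) : Q :=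
  \prod_(0 <= j < n) c (l j) (l j.+1).

Lemma holonomy0 l : holonomy l 0%N = 1.
Proof. by rewrite /holonomy big_geq. Qed.

Lemma holonomyS l n : holonomy l n.+1 = holonomy l n * c (l n) (l n.+1).
Proof. by rewrite /holonomy big_nat_recr. Qed.

Lemma holonomy_recl l n :
  holonomy l n.+1 = c (l 0%N) (l 1%N) * holonomy (fun j => l j.+1) n.
Proof. by rewrite /holonomy big_nat_recl. Qed.

Lemma holonomyD l m n :
  holonomy l (m + n) = holonomy l m * holonomy (fun j => l (m + j)%N) n.
Proof.
elim: n => [|n IHn]; first by rewrite addn0 holonomy0 mulg1.
by rewrite addnS !holonomyS IHn mulgA addnS.
Qed.

(** The corners of each square of the ladder lie in one simplex, so the cross edge slides over the
    square by two uses of the cocycle identity. *)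
Lemma holonomy_homotopy (l l' : nat -> V) (n : nat) :
  (forall j, (j < n)%N -> exists2 s, s \in simplices K &
     [/\ l j \in s, l j.+1 \in s, l' j \in s & l' j.+1 \in s]) ->
  holonomy l n * c (l n) (l' n) = c (l 0%N) (l' 0%N) * holonomy l' n.
Proof.
elim: n => [|n IHn] ll'; first by rewrite !holonomy0 mulg1 mul1g.
have [s sK [ls ls1 l's l's1]] := ll' n (ltnSn n).
have cl := simplex_closed_nbr sK.
rewrite !holonomyS -mulgA c_cocycle ?cl // -(c_cocycle (w := l' n)) ?cl //.
rewrite !mulgA -IHn // => j jn; apply: ll'; exact: leqW.
Qed.

Lemma holonomy_simplex (l : nat -> V) (n : nat) (s : {set V}) :
  s \in simplices K -> (forall j, (j <= n)%N -> l j \in s) ->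
  holonomy l n = c (l 0%N) (l n).
Proof.
move=> sK; have cl := simplex_closed_nbr sK.
elim: n => [|n IHn] ls; first by rewrite holonomy0 (cocycle1 c_cocycle).
rewrite holonomyS IHn => [|j jn]; last by apply: ls; apply: leqW.
by rewrite c_cocycle // cl ?ls.
Qed.

(** Each block of [m] steps of [l] stays on one edge of [v], a simplex, hence contributes the value
    of [c] on that edge. *)
Lemma holonomy_refine (l v : nat -> V) (n m : nat) :
  (forall k, (k < n)%N -> close (v k) (v k.+1)) ->
  (forall k, (k <= n)%N -> l (k * m)%N = v k) ->
  (forall k r, (k < n)%N -> (r <= m)%N -> l (k * m + r)%N \in [set v k; v k.+1]%SET) ->
  holonomy l (n * m) = holonomy v n.
Proof.
elim: n => [|n IHn] vv lv lvv; first by rewrite !holonomy0.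
rewrite mulSnr holonomyD holonomyS IHn => [|k kn|k kn|k r kn rm]; first last.
- by apply: lvv; rewrite // leqW.
- by apply: lv; rewrite leqW.
- by apply: vv; rewrite leqW.
congr (_ * _); rewrite (holonomy_simplex (closed_nbr_simplex (vv n _))) //.
  by rewrite addn0 -mulSnr !lv.
by move=> j jm; apply: lvv.
Qed.

(** Pairing the ends of an edge path with its holonomy lets existence arguments produce values of a
    potential without naming the path. *)
Inductive walk : V -> V -> Q -> Prop :=
| walk_nil v : walk v v 1
| walk_cons u v w q : close u v -> walk v w q -> walk u w (c u v * q).

Lemma walk_cat u v w p q : walk u v p -> walk v w q -> walk u w (p * q).
Proof.
move=> wp; elim: wp q => {u v p} [v q|u v v' p uv _ IHp q /IHp]; first by rewrite mul1g.
by rewrite -mulgA; apply: walk_cons.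
Qed.

Lemma walk_rev v w q : walk v w q -> walk w v q^-1.
Proof.
elim=> {v w q} [v|u v w q uv _ IHq]; first by rewrite invg1; apply: walk_nil.
rewrite invgM -(cocycleV c_cocycle) //; apply: (walk_cat IHq).
by rewrite -[c v u]mulg1; apply: walk_cons (walk_nil _); rewrite closed_nbr_sym.
Qed.

Lemma walk_holonomy v w q : walk v w q -> exists l n,
  [/\ l 0%N = v, l n = w, forall k, (k < n)%N -> close (l k) (l k.+1)
    & q = holonomy l n].
Proof.
elim=> {v w q} [v|u v w q uv _ [l [n [l0 ln ll ->]]]].
  by exists (fun=> v), 0%N; split=> //; rewrite holonomy0.
exists (fun j => if j is j'.+1 then l j' else u), n.+1; split=> //.
  by case=> [|k]; [rewrite l0|apply: ll].
by rewrite holonomy_recl l0.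
Qed.

End Holonomy.

(** * Piecewise linear paths in the realization *)

Section PiecewiseLinear.
Local Open Scope ring_scope.
Local Open Scope classical_set_scope.
Variables (R : realType) (V : finType) (K : simplicial_complex V).
Local Notation close := (closed_nbr K).

Definition clamp (y : R) : R := Num.min 1 (Num.max 0 y).

Lemma clamp_ge1 y : 1 <= y -> clamp y = 1.
Proof. by move=> y1; rewrite /clamp max_r ?min_l // (le_trans ler01). Qed.

Lemma clamp_le0 y : y <= 0 -> clamp y = 0.
Proof. by move=> y0; rewrite /clamp max_l ?min_r. Qed.

Lemma clamp_id y : 0 <= y <= 1 -> clamp y = y.
Proof. by case/andP=> y0 y1; rewrite /clamp max_r ?min_r. Qed.

Lemma continuous_clamp : continuous clamp.
Proof.
move=> y; apply: (@continuous_min R R (cst 1) (fun y => Num.max 0 y)).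
  exact: cst_continuous.
apply: (@continuous_max R R (cst 0) id); first exact: cst_continuous.
exact: cvg_id.
Qed.

(** [clamp (x - i%:R)] is the fraction of edge number i already traversed at time [x]; this single
    formula spares gluing segments to get continuity. *)
Definition polygon (v : nat -> V) (n : nat) (x : R) : {ptws V -> R} :=
  fun u => (v 0%N == u)%:R +
    \sum_(i < n) clamp (x - i%:R) * ((v i.+1 == u)%:R - (v i == u)%:R).

Variables (v : nat -> V).

Lemma polygonS n x u : polygon v n.+1 x u =
  polygon v n x u + clamp (x - n%:R) * ((v n.+1 == u)%:R - (v n == u)%:R).
Proof. by rewrite /polygon big_ord_recr addrA. Qed.

Lemma polygon_end n x u : n%:R <= x -> polygon v n x u = (v n == u)%:R.
Proof.
elim: n => [|n IHn] nx; first by rewrite /polygon big_ord0 addr0.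
have n1x : n%:R + 1 <= x by rewrite -natr1 in nx.
rewrite polygonS IHn ?clamp_ge1; lra.
Qed.

(** Edges before [k] are complete and telescope; edges after [k] have not started. *)
Lemma polygon_segment n k x u : (k < n)%N -> k%:R <= x <= k.+1%:R ->
  polygon v n x u =
    (1 - (x - k%:R)) * (v k == u)%:R + (x - k%:R) * (v k.+1 == u)%:R.
Proof.
move=> + /andP[kx xk]; elim: n => // n IHn; rewrite ltnS leq_eqVlt.
case/predU1P=> [<-|kn]; rewrite polygonS.
  rewrite polygon_end // clamp_id; first by ring.
  by rewrite -natr1 in xk; apply/andP; split; lra.
have : k.+1%:R <= n%:R :> R by rewrite ler_nat.
by move=> ?; rewrite IHn // clamp_le0 ?mul0r ?addr0 //; lra.
Qed.

Lemma polygon_nat n k u : (k <= n)%N -> polygon v n k%:R u = (v k == u)%:R.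
Proof.
rewrite leq_eqVlt => /predU1P[->|kn]; first exact: polygon_end.
rewrite (polygon_segment _ kn) ?lexx ?ler_nat //=.
by rewrite subrr subr0 mul1r mul0r addr0.
Qed.

Lemma nat_segment n (x : R) : (0 < n)%N -> 0 <= x <= n%:R ->
  exists2 k, (k < n)%N & k%:R <= x <= k.+1%:R.
Proof.
elim: n => // -[|n] IHn _ /andP[x0 xn]; first by exists 0%N => //; apply/andP.
have [xn1|xn1] := leP x n.+1%:R; last by exists n.+1 => //; rewrite ltW.
by have [|k kn kx] := IHn isT; [rewrite x0|exists k => //; apply: leqW].
Qed.

Lemma continuous_polygon n : continuous (polygon v n).
Proof.
apply: continuous_ptws => u x; apply: cvgD; first exact: cvg_cst.
apply: cvg_big => [|i _]; first exact: add_continuous.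
apply: cvgM; last exact: cvg_cst.
apply: (cvg_comp (fun y : R => y - i%:R) clamp _ (@continuous_clamp _)).
by apply: cvgB; [exact: cvg_id|exact: cvg_cst].
Qed.

Lemma sum_indicator (w : V) : \sum_u (w == u)%:R = 1 :> R.
Proof.
rewrite (bigD1 w) //= eqxx big1 ?addr0 // => u uw.
by rewrite eq_sym (negbTE uw).
Qed.

Lemma realization_polygon n x : (0 < n)%N -> 0 <= x <= n%:R ->
  (forall k, (k < n)%N -> close (v k) (v k.+1)) -> realization R K (polygon v n x).
Proof.
move=> n0 x0n vv; have [k kn /[dup] kx /andP[kx1 kx2]] := nat_segment n0 x0n.
have pE u := polygon_segment u kn kx.
have sum1 : \sum_u polygon v n x u = 1.
  under eq_bigr do rewrite pE.
  rewrite big_split /= -!mulr_sumr !sum_indicator; ring.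
split=> // [u|].
  rewrite pE addr_ge0 // mulr_ge0 ?ler0n //; last by lra.
  by rewrite -natr1 in kx2; lra.
apply: simplex_face (closed_nbr_simplex (vv k kn)) _ _.
  apply/fintype.subsetP=> u; rewrite !inE; apply: contraR; rewrite negb_or.
  rewrite ![u == _]eq_sym => /andP[/negbTE uk /negbTE uk1].
  by rewrite pE uk uk1 !mulr0 addr0.
apply/eqP => s0; have : \sum_u polygon v n x u = 0.
  apply: big1 => u _; apply/eqP; have /setP/(_ u) := s0.
  by rewrite !inE => /negbFE.
by rewrite sum1 => /eqP; rewrite oner_eq0.
Qed.

End PiecewiseLinear.

(** * Labelling points by vertices *)

Section Label.
Local Open Scope ring_scope.
Variables (R : realType) (V : finType) (a : V).

(** Coordinates summing to 1 have average 1/|V|, so the default [a] never occurs on the realization.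
    A fixed threshold, rather than mere positivity, makes labels stable under small moves. *)
Definition label (p : V -> R) : V := odflt a [pick v | #|V|%:R^-1 <= p v].

Lemma card_vertices_gt0 : 0 < #|V|%:R^-1 :> R.
Proof. by rewrite invr_gt0 ltr0n; apply/card_gt0P; exists a. Qed.

Lemma label_ge p : \sum_v p v = 1 -> #|V|%:R^-1 <= p (label p).
Proof.
move=> p1; rewrite /label; case: pickP => //= pV.
suff : \sum_v p v < \sum_(v : V) #|V|%:R^-1.
  rewrite p1 sumr_const -[X in _ < X]mulr_natl divff ?ltxx //.
  by rewrite -invr_eq0 gt_eqF ?card_vertices_gt0.
apply: ltr_sum => [|v _]; last by rewrite ltNge pV.
by apply/hasP; exists a; rewrite ?mem_index_enum.
Qed.

Lemma label_gt0 p : \sum_v p v = 1 -> 0 < p (label p).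
Proof. by move=> /label_ge; apply: lt_le_trans card_vertices_gt0. Qed.

(** A coordinate of at least 1/|V| cannot vanish after a change of less than 1/|V|. Labels of all
    points near a point of the realization thus lie in one simplex, its support. *)
Lemma label_near p q : (forall v, 0 <= p v) -> \sum_v q v = 1 ->
  (forall v, `|p v - q v| < #|V|%:R^-1) -> label q \in [set v | p v != 0]%SET.
Proof.
move=> p0 q1 pq; rewrite inE gt_eqF //.
have := label_ge q1; have := pq (label q); rewrite ltr_distl.
by move=> /andP[+ _] => /(le_lt_trans _) + le; apply; rewrite subr_ge0.
Qed.

Lemma label_vertex w p : (forall u, p u = (w == u)%:R) -> label p = w.
Proof.
move=> pE; have : 0 < p (label p).
  by apply: label_gt0; under eq_bigr do rewrite pE; apply: sum_indicator.
by rewrite pE; case: eqP => //; rewrite ltxx.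
Qed.

End Label.

(** * Sampling paths and null-homotopies on grids *)

Section Connectivity.
Local Open Scope ring_scope.
Local Open Scope classical_set_scope.
Variables (R : realType) (V : finType) (K : simplicial_complex V) (a : V).
Local Notation close := (closed_nbr K).
Local Notation I := (`[0%R, 1%R] : set R).
Local Notation label := (@label R V a).

Definition vertex_point (v : V) : {ptws V -> R} := fun u => (v == u)%:R.

Lemma realization_vertex v : realization R K (vertex_point v).
Proof.
have := @realization_polygon R V K (fun=> v) 1 0 isT.
rewrite lexx ler01 => /(_ isT); have -> : polygon (fun=> v) 1 (0 : R) = vertex_point v.
  by apply/funext => u; rewrite /polygon big_ord1 [X in _ * X]subrr mulr0 addr0.
by apply=> k _; apply: closed_nbr_refl.
Qed.

(** The number of subdivisions is a multiple of [n], so that the grid contains the break points of a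
    loop of [n] edges. *)
Lemma fine_grid (d : R) (n : nat) : (0 < n)%N -> 0 < d ->
  exists2 m, (0 < m)%N & (n * m)%:R^-1 < d.
Proof.
move=> n0 d0; have d1 : 0 < d^-1 by rewrite invr_gt0.
have md := archi_boundP (ltW d1); set m := Num.bound _ in md.
have m0 : (0 < m)%N by rewrite -(ltr0n R); apply: lt_trans md.
exists m => //; rewrite invf_plt ?posrE ?ltr0n ?muln_gt0 ?n0 //.
by apply: lt_le_trans md _; rewrite ler_nat leq_pmull.
Qed.

Lemma grid_mem (N j : nat) : (0 < N)%N -> (j <= N)%N -> I (j%:R / N%:R).
Proof.
move=> N0 jN; rewrite /= in_itv /= divr_ge0 ?ler0n //=.
by rewrite ler_pdivrMr ?ltr0n // mul1r ler_nat.
Qed.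

Lemma grid_ball (N i j : nat) (d : R) : (0 < N)%N -> N%:R^-1 < d ->
  (j == i) || (j == i.+1) -> ball (i%:R / N%:R : R) d (j%:R / N%:R).
Proof.
move=> N0 Nd ij; have N1 : 0 < N%:R^-1 :> R by rewrite invr_gt0 ltr0n.
rewrite -ball_normE /ball_ /=; case/orP: ij => /eqP ->.
  by rewrite subrr normr0; apply: lt_trans Nd.
rewrite -natr1 mulrDl opprD addNKr normrN mul1r gtr0_norm //.
Qed.

Hypothesis K_sc : simply_connected R (realization R K).

(** Labels at consecutive samples of a path from [a] to [v] are closed neighbours, so [S] is carried
    from [a] to [v]. *)
Lemma vertex_connected (S : V -> Prop) :
  S a -> (forall v w, close v w -> S v -> S w) -> forall v, S v.
Proof.
move=> Sa Sclose v; have [_ pc _] := K_sc.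
have [g [cg gK g0 g1]] := pc _ _ (realization_vertex a) (realization_vertex v).
have [d d0 gd] := uniformly_continuous_on (@segment_compact R 0 1) cg
  (card_vertices_gt0 R a).
have [N N0] := @fine_grid d 1 isT d0; rewrite mul1n => Nd.
have Kg j : (j <= N)%N -> realization R K (g (j%:R / N%:R)).
  by move=> jN; apply: gK; exists (j%:R / N%:R) => //; apply: grid_mem.
suff : forall j, (j <= N)%N -> S (label (g (j%:R / N%:R))).
  move=> /(_ N (leqnn N)); rewrite divff ?pnatr_eq0 -?lt0n // g1.
  by rewrite (@label_vertex _ _ _ v).
elim=> [|j IHj] jN; first by rewrite mul0r g0 (@label_vertex _ _ _ a).
apply: Sclose (IHj (ltnW jN)).
have [p0 p1 ps] := Kg j (ltnW jN); have [_ q1 _] := Kg j.+1 jN.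
apply: (simplex_closed_nbr ps); apply: label_near => // u.
  by rewrite subrr normr0 (card_vertices_gt0 R a).
apply: gd; [exact: grid_mem (ltnW jN)|exact: grid_mem|].
by apply: grid_ball; rewrite // eqxx orbT.
Qed.

Lemma walk_loop (Q : groupType) (c : V -> V -> Q) (q : Q) :
  cocycle K c -> walk K c a a q -> q = 1%g.
Proof.
move=> cc /walk_holonomy[v [n [v0 vn vv ->]]].
have [->|n0] := posnP n; first exact: holonomy0.
have nR0 : n%:R != 0 :> R by rewrite pnatr_eq0 -lt0n.
pose g (t : R) := polygon v n (n%:R * t).
have gE0 : g 0 = vertex_point a.
  by apply/funext => u; rewrite /g mulr0 (polygon_nat _ v u (leq0n n)) v0.
have gE1 : g 1 = vertex_point a.
  by apply/funext => u; rewrite /g mulr1 (polygon_nat _ v u (leqnn n)) vn.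
have g_path : path_in (realization R K) (vertex_point a) (vertex_point a) g.
  split=> //.
    apply: continuous_subspaceT => t.
    apply: (cvg_comp (fun t => n%:R * t) (polygon v n) _ (@continuous_polygon _ _ _ _ _)).
    by apply: cvgM; [exact: cvg_cst|exact: cvg_id].
  move=> _ [t /= It <-]; move: It; rewrite in_itv /= => /andP[t0 t1].
  apply: realization_polygon => //.
  by rewrite mulr_ge0 ?ler0n //= ler_piMr ?ler0n.
have [_ _ /(_ _ _ g_path) [F [cF FK F0 F1 Fx]]] := K_sc.
have [d d0 Fd] := uniformly_continuous_on
  (compact_setX (@segment_compact R 0 1) (@segment_compact R 0 1)) cF
  (card_vertices_gt0 R a).
have [m m0] := fine_grid n0 d0; set N := (n * m)%N => Nd.
have N0 : (0 < N)%N by rewrite muln_gt0 n0.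
pose x i j : R * R := (i%:R / N%:R, j%:R / N%:R).
pose L i j := label (F (x i j)).
have Ix i j : (i <= N)%N -> (j <= N)%N -> (I `*` I) (x i j).
  by move=> iN jN; split; apply: grid_mem.
have L0 i : (i <= N)%N -> L i 0%N = a.
  move=> iN; apply: label_vertex => u.
  by rewrite /x mul0r; have [-> _] := Fx _ (grid_mem N0 iN).
have LN i : (i <= N)%N -> L i N = a.
  move=> iN; apply: label_vertex => u; rewrite /x divff ?pnatr_eq0 -?lt0n //.
  by have [_ ->] := Fx _ (grid_mem N0 iN).
(* The homotopy fixes the base point, so both ends of every row are labelled [a] and the cross edges
   there contribute 1. *)
have rows i : (i < N)%N -> holonomy c (L i) N = holonomy c (L i.+1) N.
  move=> iN; have iN' := ltnW iN.
  have := @holonomy_homotopy _ _ _ _ cc (L i) (L i.+1) N.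
  rewrite !L0 ?LN // (cocycle1 cc) mul1g mulg1; apply=> j jN; have jN' := ltnW jN.
  have [p0 p1 ps] : realization R K (F (x i j)).
    by apply: FK; exists (x i j) => //; apply: Ix.
  eexists; first exact: ps.
  (* All four corners of the square are within [d] of [x i j], so their labels lie in the support of
     [F (x i j)]. *)
  have near_ij i' j' : (i' == i) || (i' == i.+1) -> (j' == j) || (j' == j.+1) ->
      L i' j' \in [set v | F (x i j) v != 0]%SET.
    move=> ii' jj'.
    have i'N : (i' <= N)%N by case/orP: ii' => /eqP ->.
    have j'N : (j' <= N)%N by case/orP: jj' => /eqP ->.
    have [_ q1 _] : realization R K (F (x i' j')).
      by apply: FK; exists (x i' j') => //; apply: Ix.
    apply: label_near => // u; apply: Fd; [exact: Ix|exact: Ix|].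
    by split; apply: grid_ball.
  by split; apply: near_ij; rewrite eqxx ?orbT.
have top : holonomy c (L N) N = 1%g.
  rewrite (holonomy_simplex cc (simplex_vertex K a)) => [|j jN].
    by rewrite L0 ?LN // (cocycle1 cc).
  rewrite inE; apply/eqP/label_vertex => u.
  by rewrite /x divff ?pnatr_eq0 -?lt0n // F1 //; apply: grid_mem.
have bottom : holonomy c (L 0%N) N = 1%g.
  suff rows0 i : (i <= N)%N -> holonomy c (L 0%N) N = holonomy c (L i) N.
    by rewrite (rows0 N).
  elim: i => [//|i IHi] iN; exact: etrans (IHi (ltnW iN)) (rows i iN).
(* Grid time j / N on the loop is time j / m on the polygon, so each edge of [v] receives exactly
   [m] steps. *)
have LE j : (j <= N)%N -> L 0%N j = label (polygon v n (j%:R / m%:R)).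
  move=> jN; rewrite /L /x mul0r F0; last exact: grid_mem.
  have mR0 : m%:R != 0 :> R by rewrite pnatr_eq0 -lt0n.
  have -> // : g (j%:R / N%:R) = polygon v n (j%:R / m%:R).
  congr (polygon v n _); rewrite /N natrM invfM mulrCA.
  by rewrite mulVKf.
rewrite -bottom; apply/esym; apply: (holonomy_refine cc vv) => [k kn|k r kn rm].
  rewrite LE; last by rewrite /N leq_pmul2r.
  apply: label_vertex => u.
  by rewrite natrM mulfK ?pnatr_eq0 -?lt0n // polygon_nat.
have krN : (k * m + r <= N)%N.
  by apply: leq_trans (_ : k.+1 * m <= N)%N; rewrite ?leq_pmul2r // mulSnr leq_add2l.
rewrite LE //; set t := _ / _.
have kt : k%:R <= t <= k.+1%:R.
  rewrite /t ler_pdivlMr ?ler_pdivrMr ?ltr0n // -!natrM !ler_nat.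
  by rewrite leq_addr mulSnr leq_add2l.
have sum1 : \sum_u polygon v n t u = 1.
  under eq_bigr do rewrite (polygon_segment v _ kn kt).
  rewrite big_split /= -!mulr_sumr !sum_indicator; ring.
(* On this segment only the coordinates at [v k] and [v k.+1] can be non-zero, and the label has a
   positive one. *)
have := label_gt0 a sum1; rewrite (polygon_segment v _ kn kt) !inE.
rewrite ![_ == label _]eq_sym.
by case: eqP => // _; case: eqP => // _; rewrite !mulr0 addr0 ltxx.
Qed.

(** The potential [h v] is the holonomy of a chosen walk from [v] to [a]. *)
Lemma cocycle_coboundary (Q : groupType) (c : V -> V -> Q) : cocycle K c ->
  exists h : V -> Q, (h a = 1 /\ forall v w, close v w -> c v w = h v / h w)%g.
Proof.
move=> cc; have /choice[h hw] : forall v, exists q, walk K c v a q.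
  apply: vertex_connected => [|v w vw [q vq]]; first by exists 1%g; apply: walk_nil.
  by exists (c w v * q)%g; apply: walk_cons vq; rewrite closed_nbr_sym.
exists h; split=> [|v w vw]; first exact: walk_loop cc (hw a).
(* The loop runs from [a] back to [v], across the edge to [w], and on to [a]. *)
have /(walk_loop cc)/mulg1_eq := walk_cat (walk_rev cc (hw v)) (walk_cons vw (hw w)).
by rewrite invgK => ->; rewrite mulgK.
Qed.

End Connectivity.

Theorem corollary3 (R : realType) (V : finType) (K : simplicial_complex V)
    (K_nonempty : (0 < #|V|)%N) (K_flag : flag K)
    (K_sc : simply_connected R (realization R K)) :
  finitely_presented (degree_kernel K).
Proof.
have /card_gt0P[a _] := K_nonempty.
apply: (@degree_kernel_presented _ _ a).
- by move=> S Sa SS v; apply: (vertex_connected K_sc Sa SS).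
- by move=> Q c; apply: (cocycle_coboundary a K_sc).
Qed.
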